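(* Let $\mu\geq\nu>-1$ and $x\in(0,\alpha_{\nu,1})$. Then $$2^\mu\Gamma(\mu+1)x^{-\mu}d_\mu(x)\ \ge\ 2^\nu\Gamma(\nu+1)x^{-\nu}d_\nu(x),\quad\text{i.e.}\quad x^{\nu-\mu}\frac{d_\mu(x)}{d_\nu(x)}\geq 2^{\nu-\mu}\frac{\Gamma(\nu+1)}{\Gamma(\mu+1)},$$ and $$\frac{d_\mu'(x)}{d_\mu(x)}\geq\frac{d_\nu'(x)}{d_\nu(x)}.$$ Moreover, the function $x\mapsto d_\mu(x)/d_\nu(x)$ is increasing on $(0,\alpha_{\nu,1})$.
   Context: $J_\nu$ denotes the Bessel function of the first kind of order $\nu$. The Dini function is $d_\nu(x)=(1-\nu)J_\nu(x)+xJ_\nu'(x)$, and $\alpha_{\nu,1}$ denotes its first positive zero (one has $\alpha_{\nu,1}\le\alpha_{\mu,1}$ for $\mu\ge\nu>-1$). *)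

(* Defs.v *)
From Stdlib Require Import Reals Lra ClassicalEpsilon Arith Factorial.
Open Scope R_scope.

Fixpoint poch_prod (s : R) (n : nat) : R :=
  match n with
  | O => s
  | S m => poch_prod s m * (s + INR (S m))
  end.

Definition gauss_seq (s : R) (n : nat) : R :=
  INR (fact n) * Rpower (INR n) s / poch_prod s n.

(* Euler's Gamma function, defined (for s not a nonpositive integer) as the
   limit of the Gauss product. *)
Definition Gamma (s : R) : R :=
  epsilon (inhabits 0) (fun l => Un_cv (gauss_seq s) l).

(* Bessel function of the first kind (for x > 0, nu > -1):
   J_nu(x) = (x/2)^nu * sum_k (-1)^k / (k! Gamma(k+nu+1)) (x/2)^(2k). *)
Definition bessel_term (nu x : R) (k : nat) : R :=
  (-1) ^ k / (INR (fact k) * Gamma (INR k + nu + 1)) * (x / 2) ^ (2 * k).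

Definition J (nu x : R) : R :=
  Rpower (x / 2) nu *
  epsilon (inhabits 0) (fun l => infinite_sum (bessel_term nu x) l).

Definition deriv (f : R -> R) (x : R) : R :=
  epsilon (inhabits 0) (fun l => derivable_pt_lim f x l).

Definition dini (nu x : R) : R := (1 - nu) * J nu x + x * deriv (J nu) x.

Definition first_pos_zero_dini (nu a : R) : Prop :=
  0 < a /\ dini nu a = 0 /\ (forall y, 0 < y < a -> dini nu y <> 0).

(* Main.v *)
Require Import Defs.
From Stdlib Require Import Reals Lra Factorial ClassicalEpsilon.
From Coquelicot Require Import Coquelicot.
Open Scope R_scope.

(** Put [z = x^2/4]. Up to the factor [(x/2)^nu / Gamma (nu+1)], [J nu] is the
    entire series [phi_nu(z) = sum (-1)^k z^k / (k! (nu+1)_k)] and [dini nu] is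
    [D_nu = phi_nu + 2 z phi_nu'], with [D_nu(0) = 1]. Everything follows from
    [D_mu / D_nu] being nondecreasing as long as [D_nu > 0].

    A function [f] with [f(0) = 0] and [z f' >= - c f], [c > -1], is nonnegative,
    since [z^c f] is nondecreasing and vanishes at [0]. Where [D_nu] and [D_mu]
    are nonnegative, Bessel's equation makes this apply in turn to [z phi_nu],
    to [- z phi_nu'], to [- z D_nu'], to the Wronskian of [phi_nu] and [phi_mu],
    and finally to the Wronskian of [D_nu] and [D_mu]. Hence [D_mu / D_nu] is
    nondecreasing up to the first zero of [D_mu]; as it starts at [1], [D_mu]
    cannot vanish before [D_nu] does. *)

(** * Real-variable tools: monotonicity, first zeros, an Euler-type inequality *)

Lemma nondecreasing_of_derive (f df : R -> R) (a b : R) :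
  a <= b ->
  (forall t, a < t < b -> is_derive f t (df t) /\ 0 <= df t) ->
  (forall t, a <= t <= b -> continuity_pt f t) ->
  f a <= f b.
Proof.
  intros hab hd hc.
  (* [MVT_gen] only places [c] in the closed interval, where the sign of [df] at the endpoints is
     unknown; [Rabs] makes the slope nonnegative there too. *)
  destruct (MVT_gen f a b (fun t => Rabs (df t))) as [c [_ hc2]].
  - rewrite Rmin_left, Rmax_right by lra; intros t ht.
    destruct (hd t ht) as [h1 h2]; rewrite (Rabs_pos_eq _ h2); exact h1.
  - rewrite Rmin_left, Rmax_right by lra; exact hc.
  - assert (0 <= Rabs (df c) * (b - a))
      by (apply Rmult_le_pos; [apply Rabs_pos | lra]); lra.
Qed.

Lemma is_derive_continuity_pt (f : R -> R) (x l : R) :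
  is_derive f x l -> continuity_pt f x.
Proof.
  intros h; apply derivable_continuous_pt; exists l; apply is_derive_Reals, h.
Qed.

(** The zero is the supremum of the [t <= b] such that [f] is positive on all of [[0, t]]. *)
Lemma first_exit (f : R -> R) (b : R) :
  (forall t, continuity_pt f t) -> 0 < f 0 -> 0 <= b -> f b <= 0 ->
  exists y, 0 < y <= b /\ f y = 0 /\ (forall u, 0 <= u < y -> 0 < f u).
Proof.
  intros hc h0 hb hfb.
  assert (hloc : forall t, f t <> 0 ->
            exists d, 0 < d /\ forall u, Rabs (u - t) < d -> 0 < f u * f t).
  { intros t ht.
    destruct (hc t (Rabs (f t))) as [d [hd hd2]]; [apply Rabs_pos_lt, ht |].
    exists d; split; [exact hd |]; intros u hu.
    destruct (Req_dec u t) as [-> | hne]; [nra |].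
    assert (h : Rabs (f u - f t) < Rabs (f t)).
    { apply hd2; split; [split; [exact I | auto] | exact hu]. }
    revert h; unfold Rabs; destruct (Rcase_abs (f u - f t));
      destruct (Rcase_abs (f t)); intros; nra. }
  set (S := fun t => 0 <= t <= b /\ forall u, 0 <= u <= t -> 0 < f u).
  destruct (completeness S) as [y [hub hlub]].
  - exists b; intros t [ht _]; lra.
  - exists 0; split; [lra |]; intros u hu; replace u with 0 by lra; exact h0.
  - assert (hyb : y <= b) by (apply hlub; intros t [ht _]; lra).
    assert (hpos : forall u, 0 <= u < y -> 0 < f u).
    { intros u hu; destruct (Rle_dec (f u) 0) as [hle | hgt]; [exfalso | lra].
      assert (y <= u); [| lra].
      apply hlub; intros t [ht htf]; destruct (Rle_dec t u); [assumption | exfalso].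
      assert (0 < f u) by (apply htf; lra); lra. }
    assert (hy0 : 0 <= y).
    { apply hub; split; [lra |]; intros u hu; replace u with 0 by lra; exact h0. }
    (* If [f y] were nonzero, positivity just left of [y] would force [0 < f y]; then [y < b], and
       [S] would contain points beyond [y]. *)
    assert (hy : f y = 0).
    { destruct (Req_dec (f y) 0) as [h | hne]; [exact h | exfalso].
      destruct (hloc y hne) as [d [hd hdf]].
      assert (hfy : 0 < f y).
      { destruct (Req_dec y 0) as [-> | hy1]; [exact h0 |].
        assert (0 < f (Rmax 0 (y - d / 2))).
        { apply hpos; unfold Rmax; destruct (Rle_dec 0 (y - d / 2)); lra. }
        assert (0 < f (Rmax 0 (y - d / 2)) * f y); [| nra].
        apply hdf; unfold Rmax; destruct (Rle_dec 0 (y - d / 2));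
          rewrite Rabs_left; lra. }
      assert (y < b) by (destruct (Req_dec y b); [subst; lra | lra]).
      assert (hS : S (Rmin b (y + d / 2))).
      { unfold S; split; [unfold Rmin; destruct (Rle_dec b (y + d / 2)); lra |].
        intros u hu; destruct (Rlt_dec u y); [apply hpos; lra |].
        assert (u <= y + d / 2) by (pose proof (Rmin_r b (y + d / 2)); lra).
        assert (0 < f u * f y); [apply hdf; rewrite Rabs_pos_eq; lra | nra]. }
      apply hub in hS; unfold Rmin in hS; destruct (Rle_dec b (y + d / 2)); lra. }
    exists y; split; [| split; assumption].
    split; [| exact hyb]; destruct (Req_dec y 0); [subst; lra | lra].
Qed.

Lemma is_derive_Rpower (s x : R) :
  0 < x -> is_derive (fun t => Rpower t s) x (s * Rpower x s / x).
Proof.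
  intros hx; apply is_derive_Reals.
  replace (s * Rpower x s / x) with (s * Rpower x (s - 1)).
  - apply derivable_pt_lim_power, hx.
  - replace (s - 1) with (s + - (1)) by ring.
    rewrite Rpower_plus, Rpower_Ropp, Rpower_1 by exact hx; unfold Rdiv; ring.
Qed.

(* [t^nu f(t)] is nondecreasing, and it tends to [0] at [0] because
   [f t = O(t)] and [nu + 1 > 0]. *)
Lemma nonneg_of_euler_inequality (nu y : R) (f df : R -> R) :
  -1 < nu -> f 0 = 0 ->
  (forall t, is_derive f t (df t)) ->
  (forall t, 0 < t < y -> - nu * f t <= t * df t) ->
  forall t, 0 < t < y -> 0 <= f t.
Proof.
  intros hnu h0 hd hi t ht.
  destruct (Rle_dec 0 (f t)) as [h | hneg]; [exact h | exfalso].
  pose proof (hd 0) as hd0; apply is_derive_Reals in hd0.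
  destruct (hd0 1 Rlt_0_1) as [d hdl].
  set (C := Rabs (df 0) + 1).
  assert (hC : 0 < C) by (unfold C; pose proof (Rabs_pos (df 0)); lra).
  (* The difference quotient at [0] is within [1] of [df 0], hence at most [C] in absolute value. *)
  assert (hbound : forall u, 0 < u < d -> - f u <= C * u).
  { intros u hu.
    assert (h : Rabs ((f (0 + u) - f 0) / u - df 0) < 1)
      by (apply hdl; [lra | rewrite Rabs_pos_eq; lra]).
    rewrite Rplus_0_l, h0, Rminus_0_r in h; apply Rabs_def2 in h.
    pose proof (Rle_abs (- df 0)) as h1; rewrite Rabs_Ropp in h1.
    assert (h2 : f u / u * u = f u) by (field; lra).
    unfold C; nra. }
  set (h := fun u => Rpower u nu * f u).
  assert (hmono : forall u, 0 < u <= t -> h u <= h t).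
  { intros u hu.
    assert (hder : forall v, 0 < v ->
        is_derive h v (Rpower v nu / v * (nu * f v + v * df v))).
    { intros v hv.
      replace (Rpower v nu / v * (nu * f v + v * df v)) with
        (plus (mult (nu * Rpower v nu / v) (f v)) (mult (Rpower v nu) (df v))).
      - apply (is_derive_mult (fun t => Rpower t nu) f);
          [apply is_derive_Rpower, hv | apply hd | intros; apply Rmult_comm].
      - unfold plus, mult; simpl; field; lra. }
    apply (nondecreasing_of_derive h
             (fun v => Rpower v nu / v * (nu * f v + v * df v))); [lra | |].
    - intros v hv; split; [apply hder; lra |].
      assert (hv0 : 0 < Rpower v nu / v)
        by (apply Rdiv_lt_0_compat; [apply exp_pos | lra]).
      assert (hv1 : - nu * f v <= v * df v) by (apply hi; lra).
      apply Rmult_le_pos; lra.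
    - intros v hv; eapply is_derive_continuity_pt, hder; lra. }
  assert (hht : h t < 0) by (unfold h; pose proof (exp_pos (nu * ln t)); unfold Rpower; nra).
  (* With [w^(nu+1) <= e], the linear bound gives [h w >= - C e = h t / 2 > h t], against
     [h w <= h t]. *)
  set (e := - h t / (2 * C)).
  assert (he : 0 < e) by (unfold e; apply Rdiv_lt_0_compat; lra).
  set (w := Rmin (Rmin t (d / 2)) (Rpower e (/ (nu + 1)))).
  pose proof (cond_pos d) as hdpos.
  assert (hw : 0 < w /\ w <= t /\ w < d /\ w <= Rpower e (/ (nu + 1))).
  { unfold w; pose proof (Rmin_l (Rmin t (d / 2)) (Rpower e (/ (nu + 1)))).
    pose proof (Rmin_r (Rmin t (d / 2)) (Rpower e (/ (nu + 1)))).
    pose proof (Rmin_l t (d / 2)); pose proof (Rmin_r t (d / 2)).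
    repeat split; try lra.
    repeat apply Rmin_glb_lt; try lra; apply exp_pos. }
  destruct hw as [hw0 [hw1 [hw2 hw3]]].
  assert (hwe : Rpower w (nu + 1) <= e).
  { replace e with (Rpower (Rpower e (/ (nu + 1))) (nu + 1)).
    - apply Rle_Rpower_l; lra.
    - rewrite Rpower_mult, Rinv_l by lra; apply Rpower_1, he. }
  pose proof (hmono w ltac:(lra)) as hm; unfold h at 1 in hm.
  pose proof (hbound w ltac:(lra)) as hb.
  rewrite Rpower_plus, Rpower_1 in hwe by lra.
  assert (hee : e * (2 * C) = - h t) by (unfold e; field; lra).
  assert (hp : 0 < Rpower w nu) by apply exp_pos.
  assert (Rpower w nu * (- f w) <= Rpower w nu * (C * w))
    by (apply Rmult_le_compat_l; lra).
  nra.
Qed.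

(** * The normalized Bessel and Dini series *)

(** Rising factorial with [k] factors, whereas [poch_prod s k] has [k + 1]. *)
Fixpoint poch (s : R) (k : nat) : R :=
  match k with
  | O => 1
  | S m => poch s m * (s + INR m)
  end.

Lemma poch_pos (s : R) (k : nat) : 0 < s -> 0 < poch s k.
Proof.
  intros hs; induction k as [| k IH]; simpl; [lra |].
  apply Rmult_lt_0_compat; [exact IH | pose proof (pos_INR k); lra].
Qed.

Definition phi_coef (nu : R) (k : nat) : R :=
  (-1) ^ k / (INR (fact k) * poch (nu + 1) k).

(* [J nu x = (x/2)^nu phi nu (x^2/4) / Gamma (nu+1)] *)
Definition phi (nu z : R) : R := PSeries (phi_coef nu) z.
Definition psi (nu z : R) : R := PSeries (PS_derive (phi_coef nu)) z.

Lemma phi_coef_den_pos (nu : R) (k : nat) :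
  -1 < nu -> 0 < INR (fact k) * poch (nu + 1) k.
Proof.
  intros hnu; apply Rmult_lt_0_compat; [apply INR_fact_lt_0 | apply poch_pos; lra].
Qed.

Lemma phi_coef_neq_0 (nu : R) (k : nat) : -1 < nu -> phi_coef nu k <> 0.
Proof.
  intros hnu; unfold phi_coef; pose proof (phi_coef_den_pos nu k hnu).
  apply Rmult_integral_contrapositive_currified.
  - apply pow_nonzero; lra.
  - apply Rinv_neq_0_compat; lra.
Qed.

(** This recurrence is Bessel's equation read on coefficients; it also gives the ratio test. *)
Lemma phi_coef_S (nu : R) (k : nat) : -1 < nu ->
  phi_coef nu (S k) * (INR (S k) * (nu + 1 + INR k)) = - phi_coef nu k.
Proof.
  intros hnu; unfold phi_coef.
  pose proof (poch_pos (nu + 1) k ltac:(lra)); pose proof (INR_fact_lt_0 k).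
  pose proof (pos_INR k).
  rewrite fact_simpl, mult_INR, S_INR; simpl poch; simpl pow; field; repeat split; lra.
Qed.

Lemma CV_radius_phi (nu : R) : -1 < nu -> CV_radius (phi_coef nu) = p_infty.
Proof.
  intros hnu; apply CV_radius_infinite_DAlembert.
  - intros k; apply phi_coef_neq_0, hnu.
  (* Skipping the first ratio makes the factor [nu + 1 + INR (S k)] exceed [1]; at index [0] it is
     [nu + 1], which may be arbitrarily small. *)
  - apply is_lim_seq_incr_1.
    apply is_lim_seq_le_le with (fun _ => 0) (fun k => / INR (S k)).
    + intros k; split; [apply Rabs_pos |].
      pose proof (phi_coef_S nu (S k) hnu) as h.
      pose proof (phi_coef_neq_0 nu (S k) hnu); pose proof (pos_INR k).
      replace (phi_coef nu (S (S k)) / phi_coef nu (S k))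
        with (- / (INR (S (S k)) * (nu + 1 + INR (S k)))).
      * rewrite !S_INR in *; rewrite Rabs_Ropp, Rabs_pos_eq.
        -- apply Rinv_le_contravar; nra.
        -- apply Rlt_le, Rinv_0_lt_compat; nra.
      * rewrite !S_INR in *; replace (phi_coef nu (S k)) with
          (- (phi_coef nu (S (S k)) * ((INR k + 1 + 1) * (nu + 1 + (INR k + 1))))) by lra.
        field; pose proof (phi_coef_neq_0 nu (S (S k)) hnu); repeat split; lra.
    + apply is_lim_seq_const.
    + apply (is_lim_seq_incr_1 (fun k => / INR k)).
      replace (Finite 0) with (Rbar_inv p_infty) by reflexivity.
      apply is_lim_seq_inv; [apply is_lim_seq_INR | discriminate].
Qed.

Lemma is_derive_phi (nu z : R) : -1 < nu -> is_derive (phi nu) z (psi nu z).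
Proof.
  intros hnu; apply is_derive_PSeries; rewrite CV_radius_phi; [exact I | exact hnu].
Qed.

(* Bessel's equation [z phi'' + (nu+1) phi' + phi = 0] *)
Lemma is_derive_z_psi (nu z : R) : -1 < nu ->
  is_derive (fun t => t * psi nu t) z (- nu * psi nu z - phi nu z).
Proof.
  intros hnu.
  assert (hin : forall a : nat -> R, CV_radius a = p_infty -> ex_pseries a z)
    by (intros a ha; apply CV_radius_inside; rewrite ha; exact I).
  pose proof (CV_radius_phi nu hnu) as hr.
  assert (hr1 : CV_radius (PS_derive (phi_coef nu)) = p_infty)
    by (rewrite CV_radius_derive; exact hr).
  assert (hr2 : CV_radius (PS_incr_1 (PS_derive (phi_coef nu))) = p_infty)
    by (rewrite CV_radius_incr_1; exact hr1).
  apply (is_derive_ext (PSeries (PS_incr_1 (PS_derive (phi_coef nu))))).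
  { intros t; apply PSeries_incr_1. }
  replace (- nu * psi nu z - phi nu z) with
    (PSeries (PS_derive (PS_incr_1 (PS_derive (phi_coef nu)))) z).
  - apply is_derive_PSeries; rewrite hr2; exact I.
  - replace (- nu * psi nu z - phi nu z) with
      (- nu * psi nu z + (-1) * phi nu z) by ring.
    unfold psi, phi; rewrite <- !PSeries_scal, <- PSeries_plus.
    + apply PSeries_ext; intros k.
      unfold PS_derive, PS_plus, PS_scal, PS_incr_1, plus, scal; simpl.
      unfold mult; simpl.
      pose proof (phi_coef_S nu k hnu) as h.
      change (match k with O => 1 | S _ => INR k + 1 end) with (INR (S k)).
      rewrite !S_INR in *; lra.
    + apply ex_pseries_scal; [apply Rmult_comm | apply hin, hr1].
    + apply ex_pseries_scal; [apply Rmult_comm | apply hin, hr].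
Qed.

(* [dini nu x = (x/2)^nu dn nu (x^2/4) / Gamma (nu+1)] *)
Definition dn (nu z : R) : R := phi nu z + 2 * (z * psi nu z).
(** The derivative of [dn nu], with the second derivative of [phi] eliminated by Bessel's
    equation. *)
Definition dn' (nu z : R) : R := (1 - 2 * nu) * psi nu z - 2 * phi nu z.

Lemma is_derive_dn (nu z : R) : -1 < nu -> is_derive (dn nu) z (dn' nu z).
Proof.
  intros hnu.
  replace (dn' nu z) with
    (plus (psi nu z) (scal 2 (- nu * psi nu z - phi nu z))).
  - apply (is_derive_plus (phi nu) (fun t => scal 2 (t * psi nu t))).
    + apply is_derive_phi, hnu.
    + apply (is_derive_scal (fun t => t * psi nu t)), is_derive_z_psi, hnu.
  - unfold dn', plus, scal; simpl; unfold mult; simpl; ring.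
Qed.

Lemma phi_0 (nu : R) : phi nu 0 = 1.
Proof. unfold phi; rewrite PSeries_0; unfold phi_coef; simpl; field. Qed.

Lemma dn_0 (nu : R) : dn nu 0 = 1.
Proof. unfold dn; rewrite phi_0; ring. Qed.

Lemma dn_continuity_pt (nu z : R) : -1 < nu -> continuity_pt (dn nu) z.
Proof. intros hnu; eapply is_derive_continuity_pt, is_derive_dn, hnu. Qed.

Lemma is_derive_Rmult (f g : R -> R) (x df dg : R) :
  is_derive f x df -> is_derive g x dg ->
  is_derive (fun t => f t * g t) x (df * g x + f x * dg).
Proof.
  intros hf hg; apply (is_derive_mult f g); [exact hf | exact hg |].
  intros; apply Rmult_comm.
Qed.

Lemma is_derive_Rminus (f g : R -> R) (x df dg : R) :
  is_derive f x df -> is_derive g x dg ->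
  is_derive (fun t => f t - g t) x (df - dg).
Proof. intros hf hg; apply (is_derive_minus f g); assumption. Qed.

Lemma is_derive_Rscal (f : R -> R) (c x df : R) :
  is_derive f x df -> is_derive (fun t => c * f t) x (c * df).
Proof. intros hf; apply (is_derive_scal f); exact hf. Qed.

Lemma is_derive_value (f : R -> R) (x l l' : R) :
  is_derive f x l -> l = l' -> is_derive f x l'.
Proof. intros h <-; exact h. Qed.

(** * Signs of [phi], [psi] and [dn'] where [dn] is nonnegative *)

Section Sign.

Variables (nu y : R).
Hypothesis hnu : -1 < nu.
Hypothesis hdn : forall t, 0 < t < y -> 0 <= dn nu t.

(** For [f = z phi], [z f' - f / 2 = (z / 2) D_nu]; this is why the exponent is [-1/2]. *)
Lemma phi_nonneg (t : R) : 0 < t < y -> 0 <= phi nu t.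
Proof.
  intros ht.
  assert (h : 0 <= t * phi nu t).
  { apply (nonneg_of_euler_inequality (- (1 / 2)) y (fun t => t * phi nu t)
             (fun t => 1 * phi nu t + t * psi nu t)); try lra.
    - intros u; apply (is_derive_Rmult (fun t => t) (phi nu));
        [apply (is_derive_id u) | apply is_derive_phi, hnu].
    - intros u hu; pose proof (hdn u hu) as h; unfold dn in h; nra. }
  destruct (Rle_dec 0 (phi nu t)); [assumption | nra].
Qed.

(** For [f = - z psi], [z f' + nu f = z phi]. The factor [t] stays because Bessel's equation is used
    as the derivative of [t * psi nu t]. *)
Lemma psi_nonpos (t : R) : 0 < t < y -> t * psi nu t <= 0.
Proof.
  intros ht.
  assert (h : 0 <= (-1) * (t * psi nu t)); [| lra].
  apply (nonneg_of_euler_inequality nu y (fun t => (-1) * (t * psi nu t))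
           (fun t => (-1) * (- nu * psi nu t - phi nu t))); try lra.
  - intros u; apply (is_derive_Rscal (fun t => t * psi nu t)), is_derive_z_psi, hnu.
  - intros u hu; pose proof (phi_nonneg u hu); nra.
Qed.

(** For [f = - z D_nu'], Bessel's equation gives [z f' + nu f = z (2 phi + D_nu)]. *)
Lemma dn'_nonpos (t : R) : 0 < t < y -> t * dn' nu t <= 0.
Proof.
  intros ht.
  assert (h : 0 <= 2 * (t * phi nu t) - (1 - 2 * nu) * (t * psi nu t));
    [| unfold dn'; lra].
  apply (nonneg_of_euler_inequality nu y
    (fun t => 2 * (t * phi nu t) - (1 - 2 * nu) * (t * psi nu t))
    (fun t => 2 * (1 * phi nu t + t * psi nu t)
              - (1 - 2 * nu) * (- nu * psi nu t - phi nu t))); try lra.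
  - intros u; apply is_derive_Rminus; apply is_derive_Rscal.
    + apply (is_derive_Rmult (fun t => t) (phi nu));
        [apply (is_derive_id u) | apply is_derive_phi, hnu].
    + apply is_derive_z_psi, hnu.
  - intros u hu; pose proof (phi_nonneg u hu); pose proof (hdn u hu) as h.
    assert (0 <= u * (2 * phi nu u + dn nu u)) by (apply Rmult_le_pos; lra).
    unfold dn in *; lra.
Qed.

End Sign.

(** * Wronskians of two orders [nu <= mu] *)

Section Comparison.

Variables (mu nu y : R).
Hypothesis hnu : -1 < nu.
Hypothesis hmunu : nu <= mu.
Hypothesis hdnu : forall t, 0 < t < y -> 0 <= dn nu t.
Hypothesis hdmu : forall t, 0 < t < y -> 0 <= dn mu t.

Let hmu : -1 < mu.
Proof. lra. Qed.

(** The products of two derivatives cancel, leaving [z V' + mu V = (mu - nu) phi_mu (- z phi_nu')],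
    which is nonnegative by the sign lemmas. *)
Lemma phi_wronskian_nonneg (t : R) : 0 < t < y ->
  0 <= phi nu t * (t * psi mu t) - phi mu t * (t * psi nu t).
Proof.
  intros ht.
  apply (nonneg_of_euler_inequality mu y
    (fun t => phi nu t * (t * psi mu t) - phi mu t * (t * psi nu t))
    (fun t => (psi nu t * (t * psi mu t) + phi nu t * (- mu * psi mu t - phi mu t))
      - (psi mu t * (t * psi nu t) + phi mu t * (- nu * psi nu t - phi nu t))));
    try lra.
  - intros u; apply is_derive_Rminus.
    + apply (is_derive_Rmult (phi nu) (fun t => t * psi mu t));
        auto using is_derive_phi, is_derive_z_psi.
    + apply (is_derive_Rmult (phi mu) (fun t => t * psi nu t));
        auto using is_derive_phi, is_derive_z_psi.
  - intros u hu.
    pose proof (phi_nonneg mu y hmu hdmu u hu).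
    pose proof (psi_nonpos nu y hnu hdnu u hu).
    assert (0 <= (mu - nu) * (phi mu u * - (u * psi nu u)))
      by (repeat apply Rmult_le_pos; lra).
    lra.
Qed.

(* With [W = z (D_nu D_mu' - D_mu D_nu')], Bessel's equation gives
   [z W' + mu W = 4 z V + (mu - nu) D_mu (- z D_nu')], where [V >= 0] is the
   Wronskian [z (phi_nu phi_mu' - phi_mu phi_nu')]. *)
Lemma dn_wronskian_nonneg (t : R) : 0 < t < y ->
  0 <= t * (dn nu t * dn' mu t - dn mu t * dn' nu t).
Proof.
  intros ht.
  (* [T n] is [t * dn' n t], expanded so that [is_derive_z_psi] applies. *)
  set (T := fun n t => (1 - 2 * n) * (t * psi n t) - 2 * (t * phi n t)).
  assert (hT : forall n u, -1 < n -> is_derive (T n) u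
    ((1 - 2 * n) * (- n * psi n u - phi n u) - 2 * (1 * phi n u + u * psi n u))).
  { intros n u hn; apply is_derive_Rminus; apply is_derive_Rscal.
    - apply is_derive_z_psi, hn.
    - apply (is_derive_Rmult (fun t => t) (phi n));
        [apply (is_derive_id u) | apply is_derive_phi, hn]. }
  replace (t * (dn nu t * dn' mu t - dn mu t * dn' nu t))
    with (dn nu t * T mu t - dn mu t * T nu t) by (unfold T, dn'; ring).
  apply (nonneg_of_euler_inequality mu y
    (fun t => dn nu t * T mu t - dn mu t * T nu t)
    (fun u => (dn' nu u * T mu u + dn nu u *
       ((1 - 2 * mu) * (- mu * psi mu u - phi mu u)
          - 2 * (1 * phi mu u + u * psi mu u)))
     - (dn' mu u * T nu u + dn mu u *
       ((1 - 2 * nu) * (- nu * psi nu u - phi nu u)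
          - 2 * (1 * phi nu u + u * psi nu u))))); try lra.
  - unfold T; ring.
  - intros u; apply is_derive_Rminus.
    + apply (is_derive_Rmult (dn nu) (T mu)); auto using is_derive_dn.
    + apply (is_derive_Rmult (dn mu) (T nu)); auto using is_derive_dn.
  - intros u hu.
    pose proof (phi_wronskian_nonneg u hu).
    pose proof (dn'_nonpos nu y hnu hdnu u hu).
    pose proof (hdmu u hu).
    assert (0 <= 4 * u * (phi nu u * (u * psi mu u) - phi mu u * (u * psi nu u)))
      by (apply Rmult_le_pos; lra).
    assert (0 <= (mu - nu) * (dn mu u * - (u * dn' nu u)))
      by (repeat apply Rmult_le_pos; lra).
    unfold T, dn, dn' in *; lra.
Qed.

End Comparison.

(** The derivative of the ratio is the Wronskian over [D_nu^2]. Asking only [0 <= dn mu t] inside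
    the interval allows [b] to be a zero of [dn mu]. *)
Lemma dn_ratio_nondecreasing (mu nu b : R) :
  -1 < nu -> nu <= mu ->
  (forall t, 0 <= t <= b -> 0 < dn nu t) ->
  (forall t, 0 < t < b -> 0 <= dn mu t) ->
  forall u, 0 <= u <= b -> dn mu u / dn nu u <= dn mu b / dn nu b.
Proof.
  intros hnu hmunu hdnu hdmu u hu.
  assert (hder : forall t, 0 <= t <= b ->
    is_derive (fun s => dn mu s / dn nu s) t
      ((dn' mu t * dn nu t - dn mu t * dn' nu t) / (dn nu t) ^ 2)).
  { intros t ht; apply (is_derive_div (dn mu) (dn nu)).
    - apply is_derive_dn; lra.
    - apply is_derive_dn, hnu.
    - specialize (hdnu t ht); lra. }
  apply (nondecreasing_of_derive (fun s => dn mu s / dn nu s)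
    (fun t => (dn' mu t * dn nu t - dn mu t * dn' nu t) / (dn nu t) ^ 2));
    [lra | |].
  - intros t ht; split; [apply hder; lra |].
    assert (h : 0 <= t * (dn nu t * dn' mu t - dn mu t * dn' nu t)).
    { apply (dn_wronskian_nonneg mu nu b); auto; try lra.
      intros s hs; apply Rlt_le, hdnu; lra. }
    apply Rdiv_le_0_compat.
    + destruct (Rle_dec 0 (dn' mu t * dn nu t - dn mu t * dn' nu t)); [assumption | nra].
    + apply pow_lt, hdnu; lra.
  - intros t ht; eapply is_derive_continuity_pt, hder; lra.
Qed.

(* At a first zero of [dn mu] the ratio [dn mu / dn nu] would have dropped from
   [1] to [0], although it is nondecreasing up to that point. *)
Lemma dn_pos_of_le (mu nu b : R) :
  -1 < nu -> nu <= mu ->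
  (forall t, 0 <= t < b -> 0 < dn nu t) ->
  forall t, 0 <= t < b -> 0 < dn mu t.
Proof.
  intros hnu hmunu hdnu t ht.
  destruct (Rlt_dec 0 (dn mu t)) as [h | h]; [exact h | exfalso].
  destruct (first_exit (dn mu) t) as [z [hz [hz0 hzpos]]]; try lra.
  - intros s; apply dn_continuity_pt; lra.
  - rewrite dn_0; lra.
  - assert (hr : dn mu 0 / dn nu 0 <= dn mu z / dn nu z).
    { apply (dn_ratio_nondecreasing mu nu z); auto; try lra.
      - intros s hs; apply hdnu; lra.
      - intros s hs; apply Rlt_le, hzpos; lra. }
    rewrite hz0, !dn_0 in hr; lra.
Qed.

(** * The Gamma function as a limit of Gauss products *)

Lemma poch_prod_pos (s : R) (n : nat) : 0 < s -> 0 < poch_prod s n.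
Proof.
  intros hs; induction n as [| n IH]; cbn [poch_prod]; [exact hs |].
  apply Rmult_lt_0_compat; [exact IH | pose proof (pos_INR (S n)); lra].
Qed.

Lemma gauss_seq_pos (s : R) (n : nat) : 0 < s -> 0 < gauss_seq s n.
Proof.
  intros hs; unfold gauss_seq; apply Rdiv_lt_0_compat; [| apply poch_prod_pos, hs].
  apply Rmult_lt_0_compat; [apply INR_fact_lt_0 | apply exp_pos].
Qed.

Lemma exp_le (x y : R) : x <= y -> exp x <= exp y.
Proof.
  intros [h | ->]; [apply Rlt_le, exp_increasing, h | apply Rle_refl].
Qed.

Lemma ln_le_sub_1 (x : R) : 0 < x -> ln x <= x - 1.
Proof.
  intros hx; rewrite <- (ln_exp (x - 1)); apply ln_le; [exact hx |].
  pose proof (exp_ineq1_le (x - 1)); lra.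
Qed.

Lemma ln_ge_sub_inv (x : R) : 0 < x -> 1 - / x <= ln x.
Proof.
  intros hx; pose proof (ln_le_sub_1 (/ x) (Rinv_0_lt_compat _ hx)) as h.
  rewrite ln_Rinv in h by exact hx; lra.
Qed.

(** Indices start at [1], since [Rpower (INR 0) s] is a default value and not a genuine power. *)
Lemma ln_gauss_seq_S (s : R) (n : nat) : 0 < s ->
  ln (gauss_seq s (S (S n))) =
  ln (gauss_seq s (S n)) + s * ln ((INR n + 2) / (INR n + 1))
    - ln ((s + INR n + 2) / (INR n + 2)).
Proof.
  intros hs; pose proof (pos_INR n).
  pose proof (poch_prod_pos s (S n) hs) as hp; pose proof (INR_fact_lt_0 (S n)) as hf.
  assert (h1 : INR (S n) = INR n + 1) by apply S_INR.
  assert (h2 : INR (S (S n)) = INR n + 2) by (rewrite !S_INR; ring).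
  unfold gauss_seq.
  change (poch_prod s (S (S n))) with (poch_prod s (S n) * (s + INR (S (S n)))).
  rewrite (fact_simpl (S n)), mult_INR, h1, h2.
  rewrite !ln_div, !ln_mult, !ln_Rpower by
    (repeat first [lra | apply exp_pos | apply Rmult_lt_0_compat]).
  replace (s + INR n + 2) with (s + (INR n + 2)) by ring; ring.
Qed.

(** With [m = n + 2]: [s ln (m / (m - 1)) >= s / m >= ln (1 + s / m)]. *)
Lemma gauss_seq_growing (s : R) (n : nat) : 0 < s ->
  gauss_seq s (S n) <= gauss_seq s (S (S n)).
Proof.
  intros hs; pose proof (pos_INR n).
  rewrite <- (exp_ln (gauss_seq s (S n))), <- (exp_ln (gauss_seq s (S (S n))))
    by apply gauss_seq_pos, hs.
  apply exp_le; rewrite ln_gauss_seq_S by exact hs.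
  pose proof (ln_ge_sub_inv ((INR n + 2) / (INR n + 1))
    ltac:(apply Rdiv_lt_0_compat; lra)) as h1.
  pose proof (ln_le_sub_1 ((s + INR n + 2) / (INR n + 2))
    ltac:(apply Rdiv_lt_0_compat; lra)) as h2.
  replace (1 - / ((INR n + 2) / (INR n + 1))) with (/ (INR n + 2)) in h1
    by (field; lra).
  replace ((s + INR n + 2) / (INR n + 2) - 1) with (s * / (INR n + 2)) in h2
    by (field; lra).
  nra.
Qed.

Lemma gauss_seq_bounded (s : R) (n : nat) : 0 < s ->
  gauss_seq s (S n) <= exp (ln (gauss_seq s 1) + s * (s + 1)).
Proof.
  intros hs.
  (* Each logarithmic increment is at most [s (s + 1) / ((n + 1) (n + 2))], which telescopes; the
     added term makes the left side nonincreasing in [n]. *)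
  assert (h : ln (gauss_seq s (S n)) + s * (s + 1) / (INR n + 1)
              <= ln (gauss_seq s 1) + s * (s + 1)).
  { induction n as [| n IH]; [simpl INR; apply Req_le; field |].
    eapply Rle_trans; [| exact IH]; pose proof (pos_INR n).
    rewrite ln_gauss_seq_S by exact hs.
    pose proof (ln_le_sub_1 ((INR n + 2) / (INR n + 1))
      ltac:(apply Rdiv_lt_0_compat; lra)) as h1.
    pose proof (ln_ge_sub_inv ((s + INR n + 2) / (INR n + 2))
      ltac:(apply Rdiv_lt_0_compat; lra)) as h2.
    rewrite S_INR.
    replace ((INR n + 2) / (INR n + 1) - 1) with (/ (INR n + 1)) in h1 by (field; lra).
    replace (1 - / ((s + INR n + 2) / (INR n + 2))) with (s / (s + INR n + 2)) in h2
      by (field; lra).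
    assert (h3 : s * ln ((INR n + 2) / (INR n + 1)) <= s * / (INR n + 1))
      by (apply Rmult_le_compat_l; lra).
    assert (h4 : s * / (INR n + 1) - s / (s + INR n + 2)
      = s * (s + 1) / ((INR n + 1) * (s + INR n + 2))) by (field; lra).
    assert (h5 : s * (s + 1) / (INR n + 1) - s * (s + 1) / (INR n + 1 + 1)
      = s * (s + 1) / ((INR n + 1) * (INR n + 2))) by (field; lra).
    assert (h6 : s * (s + 1) / ((INR n + 1) * (s + INR n + 2))
      <= s * (s + 1) / ((INR n + 1) * (INR n + 2))).
    { apply Rmult_le_compat_l; [nra | apply Rinv_le_contravar; nra]. }
    lra. }
  assert (0 <= s * (s + 1) / (INR n + 1)).
  { apply Rlt_le, Rdiv_lt_0_compat; [nra | pose proof (pos_INR n); lra]. }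
  rewrite <- (exp_ln (gauss_seq s (S n))) by apply gauss_seq_pos, hs.
  apply exp_le; lra.
Qed.

(** A bounded growing sequence converges, so the [epsilon] in [Gamma] does choose its limit. *)
Lemma Gamma_is_lim (s : R) : 0 < s -> is_lim_seq (gauss_seq s) (Gamma s).
Proof.
  intros hs; apply is_lim_seq_Reals; unfold Gamma; apply epsilon_spec.
  destruct (ex_finite_lim_seq_incr (fun n => gauss_seq s (S n))
    (exp (ln (gauss_seq s 1) + s * (s + 1)))) as [l hl].
  - intros n; apply gauss_seq_growing, hs.
  - intros n; apply gauss_seq_bounded, hs.
  - exists l; apply is_lim_seq_Reals, is_lim_seq_incr_1, hl.
Qed.

Lemma Gamma_pos (s : R) : 0 < s -> 0 < Gamma s.
Proof.
  intros hs; apply Rlt_le_trans with (gauss_seq s 1); [apply gauss_seq_pos, hs |].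
  assert (h : Rbar_le (gauss_seq s 1) (Gamma s)); [| exact h].
  apply (is_lim_seq_le (fun _ => gauss_seq s 1) (fun n => gauss_seq s (S n))).
  - intros n; induction n as [| n IH]; [lra |].
    eapply Rle_trans; [exact IH | apply gauss_seq_growing, hs].
  - apply is_lim_seq_const.
  - apply (is_lim_seq_incr_1 (gauss_seq s)), Gamma_is_lim, hs.
Qed.

(** Both sides are [s (s + 1) ... (s + n + 1)]. *)
Lemma poch_prod_shift (s : R) (n : nat) : 0 < s ->
  s * poch_prod (s + 1) n = poch_prod s n * (s + INR n + 1).
Proof.
  intros hs; induction n as [| n IH]; [simpl; ring |].
  change (poch_prod (s + 1) (S n)) with (poch_prod (s + 1) n * (s + 1 + INR (S n))).
  change (poch_prod s (S n)) with (poch_prod s n * (s + INR (S n))).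
  rewrite <- Rmult_assoc, IH, S_INR; ring.
Qed.

Lemma Gamma_S (s : R) : 0 < s -> Gamma (s + 1) = s * Gamma s.
Proof.
  intros hs.
  assert (h : is_lim_seq (fun n => gauss_seq (s + 1) (S n)) (s * (1 * Gamma s))).
  (* The Gauss products satisfy [G_n(s + 1) = s (n / (n + s + 1)) G_n(s)]; the middle factor,
     written [1 / (1 + (s + 1) / n)], tends to [1]. *)
  { apply is_lim_seq_ext with
      (fun n => s * (/ (1 + (s + 1) * / INR (S n)) * gauss_seq s (S n))).
    - intros n; unfold gauss_seq.
      pose proof (poch_prod_shift s (S n) hs) as hp.
      pose proof (poch_prod_pos s (S n) hs).
      pose proof (poch_prod_pos (s + 1) (S n) ltac:(lra)).
      assert (hn : 0 < INR (S n)) by apply lt_0_INR, Nat.lt_0_succ.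
      rewrite Rpower_plus, Rpower_1 by exact hn.
      replace (poch_prod (s + 1) (S n))
        with (poch_prod s (S n) * (s + INR (S n) + 1) / s).
      + field; repeat split; lra.
      + rewrite <- hp; field; lra.
    - apply (is_lim_seq_scal_l _ s (1 * Gamma s)).
      apply is_lim_seq_mult'.
      + replace (Finite 1) with (Finite (/ (1 + (s + 1) * 0)))
          by (f_equal; field; lra).
        assert (hinv : is_lim_seq (fun n => / INR (S n)) 0).
        { apply (is_lim_seq_incr_1 (fun k => / INR k)).
          replace (Finite 0) with (Rbar_inv p_infty) by reflexivity.
          apply is_lim_seq_inv; [apply is_lim_seq_INR | discriminate]. }
        apply (is_lim_seq_inv _ (1 + (s + 1) * 0)).
        * apply is_lim_seq_plus'; [apply is_lim_seq_const |].
          apply (is_lim_seq_scal_l _ (s + 1) 0), hinv.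
        * intros h; injection h; lra.
      + apply (is_lim_seq_incr_1 (gauss_seq s)), Gamma_is_lim, hs. }
  pose proof (Gamma_is_lim (s + 1) ltac:(lra)) as h'.
  apply is_lim_seq_incr_1 in h'.
  apply is_lim_seq_unique in h; apply is_lim_seq_unique in h'.
  rewrite h in h'; injection h'; lra.
Qed.

Lemma Gamma_poch (nu : R) (k : nat) : -1 < nu ->
  Gamma (INR k + nu + 1) = poch (nu + 1) k * Gamma (nu + 1).
Proof.
  intros hnu; induction k as [| k IH].
  - simpl; rewrite Rmult_1_l; f_equal; ring.
  - rewrite S_INR; replace (INR k + 1 + nu + 1) with (INR k + nu + 1 + 1) by ring.
    pose proof (pos_INR k).
    rewrite Gamma_S, IH by lra; simpl; ring.
Qed.

(** * From the series to [J] and [dini] *)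

(** Valid for every real [x], as the [Rpower] factor is never expanded; it can thus be
    differentiated as an identity of functions. *)
Lemma J_phi (nu x : R) : -1 < nu ->
  J nu x = Rpower (x / 2) nu * phi nu (x * x / 4) / Gamma (nu + 1).
Proof.
  intros hnu; pose proof (Gamma_pos (nu + 1) ltac:(lra)) as hg.
  assert (hs : infinite_sum (bessel_term nu x)
                 (/ Gamma (nu + 1) * phi nu (x * x / 4))).
  { assert (hk : forall k, / Gamma (nu + 1) * (phi_coef nu k * (x * x / 4) ^ k)
                          = bessel_term nu x k).
    { intros k; unfold bessel_term, phi_coef.
      rewrite Gamma_poch by exact hnu.
      rewrite pow_mult; replace ((x / 2) ^ 2) with (x * x / 4) by field.
      pose proof (poch_pos (nu + 1) k ltac:(lra)); pose proof (INR_fact_lt_0 k).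
      field; repeat split; lra. }
    apply is_series_Reals, (is_series_ext _ _ _ hk).
    apply (is_series_scal_l (V := R_NormedModule) (/ Gamma (nu + 1))
      (fun k => phi_coef nu k * (x * x / 4) ^ k)), is_pseries_R, PSeries_correct.
    apply CV_radius_inside; rewrite CV_radius_phi by exact hnu; exact I. }
  unfold J, Rdiv; rewrite Rmult_assoc; f_equal.
  rewrite (Rmult_comm (phi _ _)); apply (uniqueness_sum (bessel_term nu x)); [| exact hs].
  apply epsilon_spec; eexists; exact hs.
Qed.

Lemma deriv_unique (f : R -> R) (x l : R) : is_derive f x l -> deriv f x = l.
Proof.
  intros h; apply is_derive_Reals in h.
  apply (uniqueness_limite f x); [| exact h].
  unfold deriv; apply epsilon_spec; exists l; exact h.
Qed.

(** Used with [f = phi nu] to differentiate [J nu], and with [f = dn nu] to differentiate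
    [dini nu]. *)
Lemma is_derive_bessel_form (nu c x : R) (f df : R -> R) :
  0 < x -> is_derive f (x * x / 4) (df (x * x / 4)) ->
  is_derive (fun t => Rpower (t / 2) nu * f (t * t / 4) / c) x
    (Rpower (x / 2) nu / c * (nu / x * f (x * x / 4) + x / 2 * df (x * x / 4))).
Proof.
  intros hx hf.
  assert (h1 : is_derive (fun t => Rpower (t / 2) nu) x (nu * Rpower (x / 2) nu / x)).
  { eapply is_derive_value.
    - apply (is_derive_comp (fun t => Rpower t nu) (fun t => t / 2)).
      + apply is_derive_Rpower; lra.
      + auto_derive; [exact I | reflexivity].
    - unfold scal; simpl; unfold mult; simpl; field; lra. }
  assert (h2 : is_derive (fun t => f (t * t / 4)) x (x / 2 * df (x * x / 4))).
  { eapply is_derive_value.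
    - apply (is_derive_comp f (fun t => t * t / 4)); [exact hf |].
      auto_derive; [exact I | reflexivity].
    - unfold scal; simpl; unfold mult; simpl; field. }
  apply (is_derive_ext (fun t => / c * (Rpower (t / 2) nu * f (t * t / 4)))).
  { intros t; unfold Rdiv; apply Rmult_comm. }
  eapply is_derive_value.
  - apply is_derive_Rscal, (is_derive_Rmult (fun t => Rpower (t / 2) nu)
      (fun t => f (t * t / 4))); [exact h1 | exact h2].
  - simpl; unfold Rdiv; ring.
Qed.

(** Up to the common factor, [x J'] contributes [nu phi + (x^2 / 2) psi]: the [nu] cancels that of
    [1 - nu], and [x^2 / 2 = 2 z]. *)
Lemma dini_dn (nu x : R) : -1 < nu -> 0 < x ->
  dini nu x = Rpower (x / 2) nu * dn nu (x * x / 4) / Gamma (nu + 1).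
Proof.
  intros hnu hx; pose proof (Gamma_pos (nu + 1) ltac:(lra)).
  assert (hd : deriv (J nu) x = Rpower (x / 2) nu / Gamma (nu + 1) *
    (nu / x * phi nu (x * x / 4) + x / 2 * psi nu (x * x / 4))).
  { apply deriv_unique.
    apply (is_derive_ext
      (fun t => Rpower (t / 2) nu * phi nu (t * t / 4) / Gamma (nu + 1))).
    - intros t; symmetry; apply J_phi, hnu.
    - apply is_derive_bessel_form; [exact hx | apply is_derive_phi, hnu]. }
  unfold dini; rewrite hd, J_phi by exact hnu; unfold dn; field; lra.
Qed.

Lemma deriv_dini (nu x : R) : -1 < nu -> 0 < x ->
  deriv (dini nu) x = Rpower (x / 2) nu / Gamma (nu + 1) *
    (nu / x * dn nu (x * x / 4) + x / 2 * dn' nu (x * x / 4)).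
Proof.
  intros hnu hx; apply deriv_unique.
  apply (is_derive_ext_loc
    (fun t => Rpower (t / 2) nu * dn nu (t * t / 4) / Gamma (nu + 1))).
  (* The ball of radius [x] about [x] contains only positive points. *)
  - exists (mkposreal x hx); intros t ht; symmetry; apply dini_dn; [exact hnu |].
    unfold ball in ht; simpl in ht; unfold AbsRing_ball, abs, minus, plus, opp in ht.
    simpl in ht; apply Rabs_def2 in ht; lra.
  - apply is_derive_bessel_form; [exact hx | apply is_derive_dn, hnu].
Qed.

Lemma normalized_dini (nu x : R) : -1 < nu -> 0 < x ->
  Rpower 2 nu * Gamma (nu + 1) * Rpower x (- nu) * dini nu x = dn nu (x * x / 4).
Proof.
  intros hnu hx; rewrite dini_dn by assumption.
  pose proof (Gamma_pos (nu + 1) ltac:(lra)).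
  assert (h : Rpower 2 nu * Rpower x (- nu) * Rpower (x / 2) nu = 1).
  { unfold Rpower; rewrite <- !exp_plus, ln_div by lra.
    rewrite <- exp_0; f_equal; ring. }
  transitivity (Rpower 2 nu * Rpower x (- nu) * Rpower (x / 2) nu * dn nu (x * x / 4)).
  - field; lra.
  - rewrite h; ring.
Qed.

Lemma dini_ratio (mu nu x : R) : -1 < nu -> -1 < mu -> 0 < x ->
  dn nu (x * x / 4) <> 0 ->
  dini mu x / dini nu x = Rpower (x / 2) (mu - nu)
    * (Gamma (nu + 1) / Gamma (mu + 1)) * (dn mu (x * x / 4) / dn nu (x * x / 4)).
Proof.
  intros hnu hmu hx h0; rewrite !dini_dn by assumption.
  pose proof (Gamma_pos (nu + 1) ltac:(lra)); pose proof (Gamma_pos (mu + 1) ltac:(lra)).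
  replace mu with (mu - nu + nu) at 1 by ring; rewrite Rpower_plus.
  assert (0 < Rpower (x / 2) nu) by apply exp_pos.
  field; repeat split; lra.
Qed.

Lemma dini_log_derive (nu x : R) : -1 < nu -> 0 < x -> dn nu (x * x / 4) <> 0 ->
  deriv (dini nu) x / dini nu x
    = nu / x + x / 2 * (dn' nu (x * x / 4) / dn nu (x * x / 4)).
Proof.
  intros hnu hx h0; rewrite deriv_dini, dini_dn by assumption.
  pose proof (Gamma_pos (nu + 1) ltac:(lra)).
  assert (0 < Rpower (x / 2) nu) by apply exp_pos.
  field; repeat split; lra.
Qed.

(** Starting from [D_nu(0) = 1], a loss of positivity yields a zero [z] of [D_nu], hence a zero
    [2 sqrt z < alpha] of [dini nu]. *)
Lemma dn_pos_before_first_zero (nu alpha : R) :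
  -1 < nu -> first_pos_zero_dini nu alpha ->
  forall t, 0 <= t < alpha * alpha / 4 -> 0 < dn nu t.
Proof.
  intros hnu [ha [_ hz]] t ht.
  destruct (Rlt_dec 0 (dn nu t)) as [h | h]; [exact h | exfalso].
  destruct (first_exit (dn nu) t) as [z [hz1 [hz0 _]]]; try lra.
  - intros s; apply dn_continuity_pt, hnu.
  - rewrite dn_0; lra.
  - assert (hs : 0 < sqrt z) by (apply sqrt_lt_R0; lra).
    assert (hss : sqrt z * sqrt z = z) by (apply sqrt_sqrt; lra).
    apply (hz (2 * sqrt z)); [split; nra |].
    rewrite dini_dn by lra.
    replace (2 * sqrt z * (2 * sqrt z) / 4) with z by lra.
    rewrite hz0; unfold Rdiv; ring.
Qed.

(** * Transfer of the comparison to [dini] through [z = x^2/4] *)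

Theorem theorem6 (mu nu alpha x : R)
  (hnu : -1 < nu) (hmunu : nu <= mu)
  (halpha : first_pos_zero_dini nu alpha)
  (hx : 0 < x < alpha) :
  Rpower 2 nu * Gamma (nu + 1) * Rpower x (- nu) * dini nu x
    <= Rpower 2 mu * Gamma (mu + 1) * Rpower x (- mu) * dini mu x
  /\ Rpower 2 (nu - mu) * Gamma (nu + 1) / Gamma (mu + 1)
    <= Rpower x (nu - mu) * (dini mu x / dini nu x)
  /\ deriv (dini nu) x / dini nu x <= deriv (dini mu) x / dini mu x
  /\ (forall y z, 0 < y -> y < z -> z < alpha ->
        dini mu y / dini nu y <= dini mu z / dini nu z).
Proof.
  assert (hmu : -1 < mu) by lra.
  set (b := alpha * alpha / 4).
  pose proof (dn_pos_before_first_zero nu alpha hnu halpha) as hpnu.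
  pose proof (dn_pos_of_le mu nu b hnu hmunu hpnu) as hpmu.
  assert (hratio : forall u v, 0 <= u <= v -> v < b ->
            dn mu u / dn nu u <= dn mu v / dn nu v).
  { intros u v hu hv; apply (dn_ratio_nondecreasing mu nu v); try lra.
    - intros t ht; apply hpnu; fold b; lra.
    - intros t ht; apply Rlt_le, hpmu; lra. }
  assert (hb : forall t, 0 < t < alpha -> 0 < t * t / 4 < b) by (intros; unfold b; nra).
  pose proof (Gamma_pos (nu + 1) ltac:(lra)); pose proof (Gamma_pos (mu + 1) ltac:(lra)).
  pose proof (hb x hx) as hxb.
  pose proof (hpnu (x * x / 4) ltac:(fold b; lra)) as hD.
  pose proof (hpmu (x * x / 4) ltac:(lra)) as hE.
  (* The monotone ratio is compared with its value [1] at the origin; the first two inequalities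
     both come from this. *)
  assert (h1 : 1 <= dn mu (x * x / 4) / dn nu (x * x / 4)).
  { pose proof (hratio 0 (x * x / 4) ltac:(lra) ltac:(lra)) as h.
    rewrite !dn_0 in h; lra. }
  assert (hDE : dn nu (x * x / 4) <= dn mu (x * x / 4)).
  { replace (dn mu (x * x / 4))
      with (dn nu (x * x / 4) * (dn mu (x * x / 4) / dn nu (x * x / 4)))
      by (field; lra); nra. }
  assert (hG : 0 < Gamma (nu + 1) / Gamma (mu + 1)) by (apply Rdiv_lt_0_compat; lra).
  split; [| split; [| split]].
  - rewrite !normalized_dini by lra; exact hDE.
  - rewrite dini_ratio by lra.
    assert (hp : Rpower x (nu - mu) * Rpower (x / 2) (mu - nu) = Rpower 2 (nu - mu)).
    { unfold Rpower; rewrite <- exp_plus, ln_div by lra; f_equal; ring. }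
    rewrite <- !Rmult_assoc, hp; unfold Rdiv at 1; rewrite Rmult_assoc.
    fold (Gamma (nu + 1) / Gamma (mu + 1)).
    assert (0 < Rpower 2 (nu - mu)) by apply exp_pos.
    rewrite <- (Rmult_1_r (Rpower 2 (nu - mu) * _)) at 1.
    apply Rmult_le_compat_l; [apply Rlt_le, Rmult_lt_0_compat |]; lra.
  - rewrite !dini_log_derive by lra.
    assert (hW : 0 <= x * x / 4 * (dn nu (x * x / 4) * dn' mu (x * x / 4)
                   - dn mu (x * x / 4) * dn' nu (x * x / 4))).
    { apply (dn_wronskian_nonneg mu nu b); try lra;
        intros t ht; apply Rlt_le; [apply hpnu | apply hpmu]; fold b; lra. }
    assert (hW' : 0 <= dn nu (x * x / 4) * dn' mu (x * x / 4)
                   - dn mu (x * x / 4) * dn' nu (x * x / 4)) by nra.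
    (* The power prefactors give [nu / x <= mu / x]; the difference of the remaining terms is
       [x / 2] times the Wronskian over [D_nu D_mu]. *)
    apply Rplus_le_compat.
    + apply Rmult_le_compat_r; [apply Rlt_le, Rinv_0_lt_compat |]; lra.
    + apply Rmult_le_compat_l; [lra |]; apply Rminus_le_0.
      replace (dn' mu (x * x / 4) / dn mu (x * x / 4)
               - dn' nu (x * x / 4) / dn nu (x * x / 4))
        with ((dn nu (x * x / 4) * dn' mu (x * x / 4)
                - dn mu (x * x / 4) * dn' nu (x * x / 4))
              / (dn nu (x * x / 4) * dn mu (x * x / 4))) by (field; lra).
      apply Rdiv_le_0_compat; [exact hW' | apply Rmult_lt_0_compat; lra].
  - intros y z hy hyz hz.
    pose proof (hb y ltac:(lra)) as hyb; pose proof (hb z ltac:(lra)) as hzb.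
    pose proof (hpnu (y * y / 4) ltac:(fold b; lra)).
    pose proof (hpnu (z * z / 4) ltac:(fold b; lra)).
    pose proof (hpmu (y * y / 4) ltac:(lra)).
    rewrite !dini_ratio by lra.
    (* The quotient is a nonnegative multiple of [(x/2)^(mu - nu)] times [D_mu / D_nu], both
       nonnegative and nondecreasing. *)
    apply Rmult_le_compat.
    + apply Rlt_le, Rmult_lt_0_compat; [apply exp_pos | exact hG].
    + apply Rlt_le, Rdiv_lt_0_compat; lra.
    + apply Rmult_le_compat_r; [lra |]; apply Rle_Rpower_l; lra.
    + apply hratio; [nra | lra].
Qed.
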